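(* Let $n\ge1$. For any integer $K\ge 1$ and any $\alpha>0$ there exist closed convex proper functions $f,g:\mathbb{R}^n\to\mathbb{R}\cup\{+\infty\}$, for which there are $x^\star,u^\star\in\mathbb{R}^n$ with $0\in\partial f(x^\star)+u^\star$ and $0\in\partial g^*(u^\star)-x^\star$, and points $x^0,u^0\in\mathbb{R}^n$, $x\in\mathrm{dom}\, f$, $u\in\mathrm{dom}\, g^*$ such that $\|x^0-x\|^2+\alpha^2\|u^0-u\|^2=1$ and $$\mathcal{L}(\bar x^K,u)-\mathcal{L}(x,\bar u^K)=\frac{1}{\alpha(K+1)}\left(\|x^0-x\|^2+\alpha^2\|u^0-u\|^2\right),$$ where $\bar x^K=\frac1K\sum_{k=1}^K x^k$, $\bar u^K=\frac1K\sum_{k=1}^K u^k$, and $\{(x^k,u^k)\}_{k\ge0}$ is generated from $(x^0,u^0)$ by $$u^{k+1}=\mathrm{prox}_{\alpha^{-1}g^*}\big(u^k+\tfrac1\alpha x^k\big),\qquad x^{k+1}=\mathrm{prox}_{\alpha f}\big(x^k-\alpha(2u^{k+1}-u^k)\big),\qquad k=0,1,2,\dots$$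
   Context: $\langle\cdot,\cdot\rangle$ and $\|\cdot\|$ are the standard inner product and Euclidean norm on $\mathbb{R}^n$. $g^*(y)=\sup_x\{\langle y,x\rangle-g(x)\}$ is the Fenchel conjugate, $\partial$ the convex subdifferential, and $\mathrm{prox}_\varphi(x)=\arg\min_{y}\{\varphi(y)+\frac12\|y-x\|^2\}$. The Lagrangian is $\mathcal{L}(x,u)=f(x)+\langle u,x\rangle-g^*(u)$. The iteration is the Douglas--Rachford splitting algorithm (variant DRS-$gf$) for minimizing $f+g$. *)

(* Defs.v *)
From HB Require Import structures.
From mathcomp Require Import all_boot all_order all_algebra.
From mathcomp Require Import all_classical all_reals all_analysis.

Set Implicit Arguments.
Unset Strict Implicit.
Unset Printing Implicit Defensive.

Import Order.TTheory GRing.Theory Num.Theory.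
Import numFieldNormedType.Exports.

Local Open Scope classical_set_scope.
Local Open Scope ring_scope.

Section convex_analysis.
Context {R : realType} {n : nat}.
Implicit Types (x y u p s : 'rV[R]_n) (f g phi : 'rV[R]_n -> \bar R).

Definition inner x y : R := \sum_i x 0 i * y 0 i.

(* The norm `|x| that the library puts on 'rV[R]_n is the sup norm, hence a
   separate definition; the two norms induce the same topology. *)
Definition enorm x : R := Num.sqrt (inner x x).

Definition dom f : set 'rV[R]_n := [set x | (f x < +oo)%E].

Definition epigraph f : set ('rV[R]_n * R) := [set z | (f z.1 <= z.2%:E)%E].

Definition proper_fun f : Prop := (forall x, f x != -oo%E) /\ (dom f !=set0).

(* As 0 * +oo = 0 in \bar R, the cases t = 0 and t = 1 are trivially true. *)
Definition convex_fun f : Prop := forall x y (t : R), 0 <= t <= 1 ->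
  (f (t *: x + (1 - t) *: y)%R <= t%:E * f x + (1 - t)%R%:E * f y)%E.

Definition closed_convex_proper f : Prop :=
  [/\ closed (epigraph f), convex_fun f & proper_fun f].

Definition fenchel g y : \bar R :=
  ereal_sup [set ((inner y x)%:E - g x)%E | x in [set: 'rV[R]_n]].

Definition subdiff f x : set 'rV[R]_n :=
  [set s | forall y, (f x + (inner s (y - x)%R)%:E <= f y)%E].

Definition argmin phi : set 'rV[R]_n := [set p | forall q, (phi p <= phi q)%E].

(* prox is set-valued here; that p is the proximal point is expressed by
   prox phi x = [set p], i.e. p is the one and only minimizer. *)
Definition prox phi x : set 'rV[R]_n :=
  argmin (fun y => (phi y + (2^-1 * enorm (y - x) ^+ 2)%R%:E)%E).

Definition lagrangian f g x u : \bar R :=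
  (f x + (inner u x)%:E - fenchel g u)%E.

Definition drs_iterates f g (alpha : R) x0 u0 (xs us : nat -> 'rV[R]_n) : Prop :=
  [/\ xs 0%N = x0, us 0%N = u0 & forall k : nat,
    prox (fun v => ((alpha^-1)%:E * fenchel g v)%E)
      (us k + alpha^-1 *: xs k) = [set us k.+1] /\
    prox (fun z => (alpha%:E * f z)%E)
      (xs k - alpha *: (2 *: us k.+1 - us k)) = [set xs k.+1]].

Definition ergodic_mean (xs : nat -> 'rV[R]_n) (K : nat) : 'rV[R]_n :=
  K%:R^-1 *: \sum_(1 <= k < K.+1) xs k.

End convex_analysis.

(* Main.v *)
Require Import Defs.
From HB Require Import structures.
From mathcomp Require Import all_boot all_order all_algebra.
From mathcomp Require Import all_classical all_reals all_analysis.
From mathcomp Require Import ring lra.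
Import Order.TTheory GRing.Theory Num.Theory.
Import numFieldNormedType.Exports.
Local Open Scope classical_set_scope.
Local Open Scope ring_scope.

(** The worst case is one-dimensional and has g = 0.  Then g^* is the indicator
    of {0}, so u^k = 0 from k = 1 on, and the x-iteration is the proximal point
    method for f started at z = x^0 + alpha u^0.  The dual variable matters only
    through u^0: spreading the starting point evenly, x^0 = alpha u^0 = z / 2,
    makes |z|^2 twice |x^0|^2 + alpha^2 |u^0|^2, which is where the bound gains
    its factor 2 over the proximal point method.

    For f = c |.| along one axis, each proximal step moves by d = alpha c
    towards the origin.  From z = (K + 1) d the origin is reached at step K + 1,
    and the average of x^1, ..., x^K is (K + 1) d / 2 = z / 2.  With x = u = 0
    the gap is therefore c z / 2 = z^2 / (2 alpha (K + 1)), and z = sqrt 2 gives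
    both the normalization and the claimed value; this c maximizes the gap among
    all slopes.

    Both proximal steps are computed by [prox_subgrad], the optimality condition
    x - p \in subdiff phi p, and [fenchel0] identifies g^*. *)

(** * Inner product *)

Section inner_product.
Context {R : realType} {n : nat}.
Implicit Types x y p : 'rV[R]_n.

Lemma inner_ge0 x : 0 <= inner x x.
Proof. by apply: sumr_ge0 => i _; rewrite -expr2 sqr_ge0. Qed.

Lemma inner_eq0 x : (inner x x == 0) = (x == 0).
Proof.
apply/eqP/eqP => [x0|->]; last by rewrite /inner big1// => i _; rewrite mxE mul0r.
apply/rowP => i; rewrite mxE; apply/eqP; rewrite -sqrf_eq0 expr2.
have /psumr_eq0P : inner x x = 0 by [].
by move=> ->// j _; rewrite -expr2 sqr_ge0.
Qed.

Lemma inner0l x : inner 0 x = 0.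
Proof. by rewrite /inner big1// => i _; rewrite mxE mul0r. Qed.

Lemma inner0r x : inner x 0 = 0.
Proof. by rewrite /inner big1// => i _; rewrite mxE mulr0. Qed.

Lemma innerZl (a : R) x y : inner (a *: x) y = a * inner x y.
Proof. by rewrite /inner mulr_sumr; apply: eq_bigr => i _; rewrite mxE mulrA. Qed.

Lemma innerZr (a : R) x y : inner x (a *: y) = a * inner x y.
Proof. by rewrite /inner mulr_sumr; apply: eq_bigr => i _; rewrite mxE mulrCA. Qed.

Lemma inner_delta (i : 'I_n) x : inner (delta_mx 0 i) x = x 0 i.
Proof.
rewrite /inner (bigD1 i)//= big1 => [|j ji]; last by rewrite mxE (negbTE ji) mul0r.
by rewrite mxE !eqxx mul1r addr0.
Qed.

Lemma enorm_sqr x : enorm x ^+ 2 = inner x x.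
Proof. by rewrite sqr_sqrtr ?inner_ge0. Qed.

Lemma enorm_sqr_sub x y p : enorm (y - x) ^+ 2 =
  enorm (p - x) ^+ 2 + enorm (y - p) ^+ 2 - 2 * inner (x - p) (y - p).
Proof.
rewrite !enorm_sqr /inner mulr_sumr -big_split -sumrB /=.
by apply: eq_bigr => i _; rewrite !mxE; ring.
Qed.

End inner_product.

(** * Proximal points *)

Section proximal_points.
Context {R : realType} {n : nat}.
Implicit Types (x p : 'rV[R]_n) (phi : 'rV[R]_n -> \bar R).

(** The subgradient inequality cancels the cross term of [enorm_sqr_sub], so the
    proximal objective exceeds its value at p by at least half the squared
    distance to p. *)
Lemma prox_subgrad phi x p : phi p \is a fin_num ->
  subdiff phi p (x - p) -> prox phi x = [set p].
Proof.
case phip : (phi p) => [r||]// _ sub.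
apply/seteqP; split => [q /(_ p)|_ -> q] /=; have := sub q; rewrite phip.
- rewrite (enorm_sqr_sub x q p); case: (phi q) => [t||]//.
  rewrite -!EFinD !lee_fin => h1 h2.
  have /eqP : inner (q - p) (q - p) = 0.
    by have := inner_ge0 (q - p); rewrite -enorm_sqr; lra.
  by rewrite inner_eq0 subr_eq0 => /eqP.
- rewrite (enorm_sqr_sub x q p); case: (phi q) => [t||]//; last by move=> _; exact: leey.
  rewrite -!EFinD !lee_fin => h1.
  by have := inner_ge0 (q - p); rewrite -enorm_sqr; lra.
Qed.

End proximal_points.

(** * The function g = 0 and its conjugate *)

Section zero_function.
Context {R : realType} {n : nat}.
Implicit Types x y : 'rV[R]_n.

Lemma fenchel0 y : fenchel (cst 0%E) y = if y == 0 then 0%E else +oo%E.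
Proof.
rewrite /fenchel; case: eqP => [->|/eqP y0].
  rewrite (_ : [set _ | _ in _] = [set 0%E]) ?ereal_sup1//.
  apply/seteqP; split => [_ [x _ <-]|_ ->]/=; first by rewrite inner0l sube0.
  by exists 0; rewrite // inner0l sube0.
apply/eq_infty => r; apply: ereal_sup_ubound.
exists ((r / inner y y) *: y) => //=.
by rewrite sube0 innerZr divfK// inner_eq0.
Qed.

Lemma prox_fenchel0 (a : R) x : 0 < a ->
  prox (fun v => (a%:E * fenchel (cst 0%E) v)%E) x = [set 0].
Proof.
move=> a0; apply: prox_subgrad; first by rewrite fenchel0 eqxx mule0.
move=> y; rewrite !fenchel0 eqxx mule0 add0e !subr0.
by case: eqP => [->|_]; rewrite ?mule0 ?inner0r// gt0_muley ?lte_fin ?leey.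
Qed.

End zero_function.

(** * The function f = c |x_i| *)

Section weighted_abs.
Context {R : realType} {n : nat}.
Variables (i : 'I_n) (c : R).
Hypothesis c0 : 0 <= c.

Definition abs_coord (x : 'rV[R]_n) : \bar R := (c * `|x 0 i|)%:E.

Lemma abs_coord_ccp : closed_convex_proper abs_coord.
Proof.
split.
- pose h (z : 'rV[R]_n * R) := z.2 - c * `|z.1 0 i|.
  have -> : epigraph abs_coord = h @^-1` [set t | 0 <= t].
    by apply/seteqP; split => z; rewrite /epigraph /h /= lee_fin subr_ge0.
  apply: preimage_closed; last exact: closed_ge.
  move=> z _; apply: cvgB; first exact: cvg_snd.
  apply: cvgZr; apply: cvg_norm.
  apply: (@cvg_comp _ _ _ fst (fun x : 'rV[R]_n => x 0 i)); first exact: cvg_fst.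
  exact: coord_continuous.
- move=> x y t /andP[t0 t1]; rewrite /abs_coord -!EFinM -EFinD lee_fin !mxE.
  have := ler_normD (t * x 0 i) ((1 - t) * y 0 i).
  rewrite !normrM (ger0_norm t0) (ger0_norm (_ : 0 <= 1 - t)) ?subr_ge0//.
  move=> /(ler_wpM2l c0).
  by rewrite mulrDr (mulrCA c t) (mulrCA c (1 - t)).
- by split => //; exists 0; rewrite /dom /abs_coord /= ltry.
Qed.

Lemma subdiff_abs_coord0 : subdiff abs_coord 0 0.
Proof.
move=> y; rewrite /abs_coord inner0l mxE normr0 mulr0 adde0 lee_fin.
by rewrite mulr_ge0.
Qed.

(** Proximal points of multiples of [abs_coord] on the axis: soft thresholding,
    for an input that is 0 or at least one threshold away from 0. *)
Lemma prox_abs_coord_step (a t : R) : 0 <= a -> 0 <= t ->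
  prox (fun z => (a%:E * abs_coord z)%E) ((t + a * c) *: delta_mx 0 i)
  = [set t *: delta_mx 0 i].
Proof.
move=> a0 t0; apply: prox_subgrad; first by rewrite /abs_coord -EFinM.
move=> y; rewrite /abs_coord -!EFinM -EFinD lee_fin -scalerBl innerZl inner_delta.
rewrite !mxE !eqxx mulr1 (ger0_norm t0).
have := ler_wpM2l (mulr_ge0 a0 c0) (ler_norm (y 0 i)); lra.
Qed.

Lemma prox_abs_coord0 (a : R) : 0 <= a ->
  prox (fun z => (a%:E * abs_coord z)%E) 0 = [set 0].
Proof.
move=> a0; apply: prox_subgrad; first by rewrite /abs_coord -EFinM.
move=> y; rewrite subr0 inner0l adde0 /abs_coord -!EFinM lee_fin mxE normr0.
by rewrite !mulr0 !mulr_ge0.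
Qed.

End weighted_abs.

(** * Averages of the iterates *)

Lemma ergodic_mean_steps (R : realType) (n : nat) (d : R) (v : 'rV[R]_n)
    (xs : nat -> 'rV[R]_n) (K : nat) : (0 < K)%N ->
  (forall k, xs k.+1 = (d * (K - k)%:R) *: v) ->
  ergodic_mean xs K = (d * K.+1%:R / 2) *: v.
Proof.
move=> K0 xsE; rewrite /ergodic_mean big_add1 /=.
under eq_bigr do rewrite xsE.
rewrite -scaler_suml -mulr_sumr -natr_sum scalerA; congr (_ *: _).
have -> : (\sum_(0 <= k < K) (K - k) = 'C(K.+1, 2))%N.
  rewrite big_nat_rev /= -bin2_sum big_nat_recl// [RHS]add0n.
  by apply: eq_big_nat => k /andP[_ kK]; rewrite add0n subKn.
have Kn0 : K%:R != 0 :> R by rewrite pnatr_eq0 -lt0n.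
have C2 : 'C(K.+1, 2)%:R * 2 = K.+1%:R * K%:R :> R.
  by rewrite -!natrM mulnC -(mul_bin_diag K.+1 1) bin1.
by rewrite -[X in _ * (_ * X)](mulfK (_ : 2 != 0)) ?C2 ?pnatr_eq0//; field.
Qed.

Lemma ergodic_mean0 (R : realType) (n : nat) (us : nat -> 'rV[R]_n) (K : nat) :
  (forall k, us k.+1 = 0) -> ergodic_mean us K = 0.
Proof.
by move=> us0; rewrite /ergodic_mean big_add1 big1 ?scaler0.
Qed.

(** * The worst-case instance *)

Theorem theorem3p4 (R : realType) (n : nat) (hn : (1 <= n)%N)
    (K : nat) (hK : (1 <= K)%N) (alpha : R) (halpha : 0 < alpha) :
  exists f g : 'rV[R]_n -> \bar R,
    [/\ closed_convex_proper f,
        closed_convex_proper g,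
        exists xstar ustar : 'rV[R]_n,
          [set s + ustar | s in subdiff f xstar] 0 /\
          [set s - xstar | s in subdiff (fenchel g) ustar] 0
      & exists x0 u0 x u : 'rV[R]_n,
          [/\ dom f x,
              dom (fenchel g) u,
              enorm (x0 - x) ^+ 2 + alpha ^+ 2 * enorm (u0 - u) ^+ 2 = 1
            & exists xs us : nat -> 'rV[R]_n,
                drs_iterates f g alpha x0 u0 xs us /\
                (lagrangian f g (ergodic_mean xs K) u
                 - lagrangian f g x (ergodic_mean us K))%E
                = ((alpha * K.+1%:R)^-1
                   * (enorm (x0 - x) ^+ 2
                      + alpha ^+ 2 * enorm (u0 - u) ^+ 2))%:E]].
Proof.
pose i := Ordinal hn; pose e : 'rV[R]_n := delta_mx 0 i.
pose z : R := Num.sqrt 2.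
have z2 : z ^+ 2 = 2 by rewrite sqr_sqrtr.
have z0 : 0 <= z by rewrite sqrtr_ge0.
pose d := z / K.+1%:R; pose c := d / alpha.
have alpha_ge0 := ltW halpha; have alpha0 : alpha != 0 by rewrite gt_eqF.
have K10 : K.+1%:R != 0 :> R by rewrite pnatr_eq0.
have d0 : 0 <= d by rewrite divr_ge0.
have c0 : 0 <= c by rewrite divr_ge0.
have dE : alpha * c = d by rewrite mulrC divfK.
pose f := abs_coord i c; pose g : 'rV[R]_n -> \bar R := cst 0%E.
pose x0 := (z / 2) *: e; pose u0 := (z / 2 / alpha) *: e.
have norm1 : enorm (x0 - 0) ^+ 2 + alpha ^+ 2 * enorm (u0 - 0) ^+ 2 = 1.
  rewrite !subr0 !enorm_sqr !innerZl !innerZr inner_delta mxE !eqxx /= mulr1.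
  transitivity (z ^+ 2 / 2); last by rewrite z2 divff.
  by field.
exists f, g; split.
- exact: abs_coord_ccp.
- have -> : g = abs_coord i 0 by apply/funext => y; rewrite /abs_coord mul0r.
  exact: abs_coord_ccp.
- exists 0, 0; split; exists 0 => //=; rewrite ?addr0 ?subr0//.
    exact: subdiff_abs_coord0.
  by move=> y; rewrite inner0l adde0 !fenchel0 eqxx; case: ifP; rewrite ?leey.
- exists x0, u0, 0, 0; split => //.
  + by rewrite /dom /f /abs_coord /= ltry.
  + by rewrite /dom /= fenchel0 eqxx ltry.
  + (* The truncated subtraction keeps the iterates at the origin from step K + 1
       on. *)
    pose xs k : 'rV[R]_n := if k is k'.+1 then (d * (K - k')%:R) *: e else x0.
    pose us k : 'rV[R]_n := if k is k'.+1 then 0 else u0.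
    exists xs, us; split.
      split=> // k; split; first by apply: prox_fenchel0; rewrite invr_gt0.
      (* At k = 0 the input is x0 + alpha u0 = z e, the starting point of the
         proximal point method. *)
      have -> : xs k - alpha *: (2 *: us k.+1 - us k) = (d * (K.+1 - k)%:R) *: e.
        rewrite /= scaler0 sub0r scalerN opprK; case: k => [|k] /=.
          rewrite scalerA -scalerDl; congr (_ *: _).
          by rewrite subn0 divfK// [alpha * _]mulrC divfK// -splitr.
        by rewrite scaler0 addr0 subSS.
      (* Up to step K + 1 the input is at least d away from the origin; afterwards
         it is the origin itself. *)
      rewrite /=; have [kK|Kk] := leqP k K.
        rewrite subSn// -[(K - k).+1%:R]natr1 mulrDr mulr1 -dE.
        by apply: prox_abs_coord_step => //; rewrite dE mulr_ge0.
      have /eqP -> : (K.+1 - k == 0)%N by rewrite subn_eq0.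
      have /eqP -> : (K - k == 0)%N by rewrite subn_eq0 ltnW.
      by rewrite mulr0 scale0r; apply: prox_abs_coord0.
    rewrite norm1 (@ergodic_mean_steps _ _ d e)//.
    rewrite (@ergodic_mean0 _ _ us)// /lagrangian fenchel0 eqxx inner0l inner0r.
    rewrite !sube0 !adde0 /f /abs_coord !mxE normr0 mulr0 sube0; congr (_%:E).
    rewrite !eqxx mulr1 ger0_norm ?divr_ge0 ?mulr_ge0//.
    rewrite /c /d divfK// invfM mulr1.
    rewrite (_ : z / K.+1%:R / alpha * (z / 2) = z ^+ 2 / 2 / K.+1%:R / alpha).
      by rewrite z2 divff// mul1r mulrC.
    by rewrite expr2 !mulrA; ring.
Qed.
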